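(* Let $d\ge 1$ and equip $\mathbb R^d$ with the Euclidean norm. Then: (1) For every universal convex covering $\mathcal U$ of $\mathbb R^d$ there exist a vector $a\in\mathbb R^d$ and a real number $t>0$ such that the translated and rescaled set $t(\mathcal U+a)$ has at least $r^d$ points at distance at most $r$ from the origin, for every sufficiently large $r$. (2) There exists a universal convex covering $\mathcal U_d$ of $\mathbb R^d$ which has at most $\log(r)^{d-1}r^d$ points at distance at most $r$ from the origin, for every sufficiently large $r$.
   Context: Lebesgue measure on $\mathbb R^d$ is used for volumes. For $v>0$, a subset $\mathcal U\subset\mathbb R^d$ is a $v$-universal convex covering of $\mathbb R^d$ if $\mathcal C+\mathcal U=\mathbb R^d$ for every convex subset $\mathcal C\subset\mathbb R^d$ of volume strictly greater than $v$, where $\mathcal C+\mathcal U=\{P+Q: P\in\mathcal C, Q\in\mathcal U\}$. A subset $\mathcal U$ is a universal convex covering of $\mathbb R^d$ if it is a $v$-universal convex covering for some $v>0$. *)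

(* Defs.v *)
From HB Require Import structures.
From mathcomp Require Import all_boot all_order all_algebra.
From mathcomp Require Import all_classical all_reals all_analysis.

Set Implicit Arguments.
Unset Strict Implicit.
Unset Printing Implicit Defensive.

Import Order.TTheory GRing.Theory Num.Theory.
Import numFieldNormedType.Exports.

Local Open Scope classical_set_scope.
Local Open Scope ring_scope.

(* The library norm on row vectors is the sup norm, hence this definition. *)
Definition enorm (R : realType) (d : nat) (x : 'rV[R]_d) : R :=
  Num.sqrt (\sum_(i < d) x ord0 i ^+ 2).

Definition eball (R : realType) (d : nat) (r : R) : set 'rV[R]_d :=
  [set x | enorm x <= r].

Arguments eball {R} d r.

Definition box (R : realType) (d : nat) (ab : 'rV[R]_d * 'rV[R]_d) :
    set 'rV[R]_d :=
  [set x | forall i, ab.1 ord0 i <= x ord0 i <= ab.2 ord0 i].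

Definition box_volume (R : realType) (d : nat) (ab : 'rV[R]_d * 'rV[R]_d) : R :=
  \prod_(i < d) (ab.2 ord0 i - ab.1 ord0 i).

(* Sequences of closed boxes covering A; the sides are required to be
   nonnegative so that box_volume is the actual volume of each box. *)
Definition box_cover (R : realType) (d : nat) (A : set 'rV[R]_d) :
    set (nat -> 'rV[R]_d * 'rV[R]_d) :=
  [set F : nat -> 'rV[R]_d * 'rV[R]_d |
    (forall k i, (F k).1 ord0 i <= (F k).2 ord0 i) /\
     A `<=` \bigcup_k box (F k)].

(* Lebesgue outer measure on R^d. Lebesgue measure is its restriction to the
   Lebesgue measurable sets. It is only used on convex sets, which are always
   Lebesgue measurable (although not always Borel when d > 1), so there it is
   the Lebesgue measure. *)
Definition volume (R : realType) (d : nat) (A : set 'rV[R]_d) : \bar R :=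
  ereal_inf [set (\sum_(0 <= k <oo) (box_volume (F k))%:E : \bar R)%E
            | F in box_cover A].

Definition minkowski_sum (R : realType) (d : nat) (A B : set 'rV[R]_d) :
    set 'rV[R]_d :=
  [set p + q | p in A & q in B].

Definition v_universal_convex_covering (R : realType) (d : nat) (v : R)
    (U : set 'rV[R]_d) : Prop :=
  forall C : set 'rV[R]_d, convex_set C -> (v%:E < volume C)%E ->
    minkowski_sum C U = [set: 'rV[R]_d].

Definition universal_convex_covering (R : realType) (d : nat)
    (U : set 'rV[R]_d) : Prop :=
  exists2 v : R, 0 < v & v_universal_convex_covering v U.

(* Main.v *)
Require Import Defs.
From mathcomp Require Import all_boot all_order all_algebra all_fingroup.
From mathcomp Require Import all_classical all_reals all_analysis.
From mathcomp Require Import finmap measurable_realfun ring lra.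

(* Lower bound: disjoint cubes of volume greater than v all meet a v-universal
   covering, and the cube of side proportional to r contains at least r^d of
   them.

   Upper bound: take the union of the lattices a Z^d over the diagonal matrices
   a = diag (a_0, ..., a_n) of fixed determinant A whose last n entries are
   integral powers of e, keeping in each lattice only the points x with
   a_i <= 2^(n+2) |x| for all i.  About (log r)^n lattices contribute to the
   ball of radius r, each one at most a constant multiple of r^(n+1) / A points.
   A convex set of large volume contains a simplex of large determinant.  Push
   it by a homothety towards its farthest vertex, so that all its points x have
   norms comparable to its size.  It then contains a translate of a
   parallelepiped which Gaussian elimination with pivoting makes triangular, at
   the cost of a bounded factor.  Such a parallelepiped meets a Z^d as soon as
   the a_i are at most the diagonal entries: round the coordinates one by one. *)

Set Implicit Arguments.
Unset Strict Implicit.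
Unset Printing Implicit Defensive.
Import Order.TTheory GRing.Theory Num.Theory.
Import numFieldNormedType.Exports.

Local Open Scope classical_set_scope.
Local Open Scope ring_scope.

(** * Gaussian elimination with pivoting *)

(* Pivoting on the largest entry of the first column bounds the multipliers c
   by 1. *)
Lemma pivot_decomposition (R : realFieldType) n (E : 'M[R]_(1 + n)) :
  \det E != 0 ->
  exists (s : 'S_(1 + n)) (p : R) (u : 'rV[R]_n) (c : 'cV[R]_n) (E' : 'M[R]_n),
    [/\ E = perm_mx s *m (block_mx 1%:M 0 c 1%:M *m block_mx p%:M u 0 E'),
        p != 0, forall i, `|c i ord0| <= 1, `|\det E| = `|p| * `|\det E'| &
        forall M : R, (forall i j, `|E i j| <= M) ->
          `|p| <= M /\ forall i j, `|E' i j| <= M *+ 2].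
Proof.
move=> detE.
pose j := [arg max_(i > ord0) `|E i ord0|]%O.
have jmax i : `|E i ord0| <= `|E j ord0|.
  by rewrite /j; case: Order.TotalTheory.arg_maxP => // k _; apply.
have p0 : E j ord0 != 0.
  apply/eqP => Ej0; move/negP: detE; apply; apply/eqP.
  rewrite (expand_det_col E ord0) big1 // => i _.
  by move: (jmax i); rewrite Ej0 normr0 normr_le0 => /eqP ->; rewrite mul0r.
pose s : 'S_(1 + n) := tperm ord0 j.
pose F : 'M[R]_(1 + n) := row_perm s E.
have EF : E = perm_mx s *m F by rewrite /F row_permE mulmxA -perm_mxM tperm2 perm_mx1 mul1mx.
have F0 : F ord0 ord0 = E j ord0 by rewrite mxE tpermL.
pose p := E j ord0.
pose u := ursubmx F.
pose c : 'cV[R]_n := p^-1 *: dlsubmx F.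
pose E' := drsubmx F - c *m u.
have ulF : ulsubmx F = p%:M.
  apply/matrixP => a b; rewrite !ord1 [RHS]mxE eqxx mulr1n /p -F0 2!mxE.
  by congr (F _ _); exact: val_inj.
have FE : F = block_mx 1%:M 0 c 1%:M *m block_mx p%:M u 0 E'.
  rewrite mulmx_block !mul1mx !mul0mx !addr0 mul_mx_scalar.
  rewrite scalerA divff // scale1r /E' addrCA subrr addr0 -ulF.
  by rewrite submxK.
have c1 i : `|c i ord0| <= 1.
  rewrite !mxE normrM normfV ler_pdivrMl ?normr_gt0 // mulr1.
  rewrite (_ : lshift n 0 = ord0); last exact: val_inj.
  exact: jmax.
exists s, p, u, c, E'; split => //.
- by rewrite -FE.
- rewrite EF FE !det_mulmx det_perm det_lblock det_ublock !det1 !mul1r det_scalar1.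
  by rewrite !normrM normrX normrN1 expr1n mul1r.
- move=> M EM; split=> [|a b]; first exact: EM.
  rewrite !mxE big_ord1 mulr2n (le_trans (ler_normB _ _)) // lerD //.
  rewrite normrM -[leRHS]mul1r ler_pM // ?mxE //.
Qed.

Lemma row_mx_perm_norm (R : realFieldType) n (s : 'S_n) (t : 'rV[R]_n) K :
  (forall i, `|t ord0 i| <= K) -> forall i, `|(t *m perm_mx s) ord0 i| <= K.
Proof.
by move=> tK i; rewrite -[s]invgK -col_permE mxE.
Qed.

Lemma norm_mulmx_row_col_le (R : realFieldType) n (t : 'rV[R]_n) (c : 'cV[R]_n) K :
  (forall i, `|t ord0 i| <= K) -> (forall i, `|c i ord0| <= 1) ->
  `|(t *m c) ord0 ord0| <= n%:R * K.
Proof.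
move=> tK c1; rewrite mxE (le_trans (ler_norm_sum _ _ _)) //.
rewrite (@le_trans _ _ (\sum_(i < n) K)) //; last first.
  by rewrite sumr_const card_ord mulr_natl.
apply: ler_sum => i _; rewrite normrM -[leRHS]mulr1.
by apply: ler_pM.
Qed.

Lemma row_mx_head (R : pzRingType) n (t : R) (v : 'rV[R]_n) :
  (row_mx t%:M v : 'rV[R]_n.+1) ord0 ord0 = t.
Proof.
have -> : ord0 = lshift n ord0 :> 'I_(1 + n) by exact: val_inj.
by rewrite (row_mxEl t%:M v) mxE eqxx.
Qed.

Lemma row_mx_tail (R : pzRingType) n (t : R) (v : 'rV[R]_n) (i : 'I_n) :
  (row_mx t%:M v : 'rV[R]_n.+1) ord0 (lift ord0 i) = v ord0 i.
Proof.
have -> : lift ord0 i = rshift 1 i :> 'I_(1 + n) by exact: val_inj.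
exact: row_mxEr.
Qed.

Lemma rsubmx_tail (R : Type) n (v : 'rV[R]_n.+1) (i : 'I_n) :
  rsubmx (v : 'rV[R]_(1 + n)) ord0 i = v ord0 (lift ord0 i).
Proof. by rewrite mxE; congr (v _ _); exact: val_inj. Qed.

Lemma ord_headP n (P : 'I_n.+1 -> Prop) :
  P ord0 -> (forall i, P (lift ord0 i)) -> forall i, P i.
Proof. by move=> P0 P1 i; case: (unliftP ord0 i) => [k|] ->. Qed.

(** After the row permutation, the lower block only changes the coefficient of the pivot row, by a
    product with [c] that stays bounded because the multipliers are at most 1 in absolute value.
    Both directions are recorded: building [t] from its pieces serves to meet lattices, splitting a
    given [t] serves to cover parallelepipeds. *)
Lemma pivot_combinations (R : realFieldType) n (E : 'M[R]_n.+1) :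
  \det E != 0 ->
  exists (p : R) (u : 'rV[R]_n) (E' : 'M[R]_n),
    [/\ p != 0, `|\det E| = `|p| * `|\det E'|,
        forall M, (forall i j, `|E i j| <= M) ->
          `|p| <= M /\ forall i j, `|E' i j| <= M *+ 2,
        forall K t0 (t' : 'rV[R]_n), 0 <= K -> (forall i, `|t' ord0 i| <= K) ->
          exists2 t : 'rV[R]_n.+1,
            forall i, `|t ord0 i| <= `|t0| + n.+1%:R * K &
            t *m E = row_mx (t0 * p)%:M (t0 *: u + t' *m E') &
        forall t : 'rV[R]_n.+1, (forall i, `|t ord0 i| <= 1) ->
          exists t0 (t' : 'rV[R]_n),
            [/\ `|t0| <= n.+1%:R, forall i, `|t' ord0 i| <= 1 &
              t *m E = row_mx (t0 * p)%:M (t0 *: u + t' *m E')]].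
Proof.
move: E; rewrite -[n.+1]/(1 + n)%N => E detE.
have [s [p [u [c [E' [EE p0 c1 detEE EM]]]]]] := pivot_decomposition detE.
exists p, u, E'; split => // [K t0 t' K0 t'K|t t1].
  have y_n := norm_mulmx_row_col_le t'K c1.
  set y := (t' *m c) ord0 ord0 in y_n.
  have yE : t' *m c = y%:M by exact: mx11_scalar.
  (* Subtracting [y] cancels what the other rows add to the coefficient of the pivot row. *)
  pose t1 : 'rV[R]_(1 + n) := row_mx (t0 - y)%:M t'.
  exists (t1 *m perm_mx s^-1).
    apply: row_mx_perm_norm; apply: ord_headP => [|i].
      rewrite row_mx_head (le_trans (ler_normB _ _)) // lerD //.
      rewrite (le_trans y_n) //.
      by rewrite ler_wpM2r // ler_nat leq_addl.
    rewrite row_mx_tail (le_trans (t'K i)) //.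
    by rewrite natrD mulrDl mul1r addrCA lerDl addr_ge0 // mulr_ge0.
  rewrite EE mulmxA -[_ *m perm_mx s]mulmxA -perm_mxM mulVg perm_mx1 mulmx1.
  rewrite mulmxA mul_row_block mulmx1 mulmx0 add0r mulmx1.
  rewrite yE -(raddfD (@scalar_mx R 1)) subrK.
  by rewrite mul_row_block mulmx0 addr0 -scalar_mxM mul_scalar_mx.
pose w : 'rV[R]_(1 + n) := t *m perm_mx s.
have w1 := row_mx_perm_norm s t1; rewrite -/w in w1.
have w'1 i : `|rsubmx w ord0 i| <= 1 by rewrite mxE.
have y_n := norm_mulmx_row_col_le w'1 c1.
set y := (rsubmx w *m c) ord0 ord0 in y_n.
have yE : rsubmx w *m c = y%:M by exact: mx11_scalar.
have w0E : lsubmx w = (w ord0 ord0)%:M.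
  rewrite [LHS]mx11_scalar mxE; congr (w _ _)%:M; exact: val_inj.
exists (w ord0 ord0 + y), (rsubmx w); split => //.
  by rewrite (le_trans (ler_normD _ _)) // natrD lerD // (le_trans y_n) // mulr1.
rewrite EE mulmxA -/w mulmxA -[w in LHS]hsubmxK mul_row_block mulmx1 mulmx0 add0r.
rewrite mulmx1 yE w0E -(raddfD (@scalar_mx R 1)).
by rewrite mul_row_block mulmx0 addr0 -scalar_mxM mul_scalar_mx.
Qed.

(* alpha is the diagonal of the triangular form of E under pivoted elimination. *)
Lemma parallelepiped_meets_lattice (R : realType) n : exists2 K : R, 0 < K &
  forall E : 'M[R]_n, \det E != 0 ->
  exists alpha : 'rV[R]_n,
   [/\ forall i, 0 < alpha ord0 i,
       \prod_i alpha ord0 i = `|\det E|,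
       forall M : R, (forall i j, `|E i j| <= M) ->
         forall i, alpha ord0 i <= 2 ^+ n * M &
       forall a x0 : 'rV[R]_n, (forall i, 0 < a ord0 i <= alpha ord0 i) ->
         exists (t : 'rV[R]_n) (z : 'I_n -> int),
           (forall i, `|t ord0 i| <= K) /\
           forall i, (x0 + t *m E) ord0 i = a ord0 i * (z i)%:~R].
Proof.
elim: n => [|n [K K0 IH]].
  exists 1 => // E _; exists 0; split.
  - by case.
  - by rewrite big_ord0 det_mx00 normr1.
  - by move=> M _ [].
  - by move=> a x0 _; exists 0, (fun=> 0); split; case.
(* The 1 bounds the coefficient [t0] of the pivot row; the rest is the loss in
   [pivot_combinations]. *)
exists (1 + n.+1%:R * K); first by rewrite ltr_wpDr // mulr_ge0 // ltW.
move=> E detE.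
have [p [u [E' [p0 detEE EM tE _]]]] := pivot_combinations detE.
have detE' : \det E' != 0.
  apply: contra_neq detE => d0; apply/eqP.
  by rewrite -normr_eq0 detEE d0 normr0 mulr0.
have [alpha [alpha0 alphaE alphaM alphaZ]] := IH E' detE'.
exists (row_mx (`|p|%:M : 'rV_1) alpha : 'rV[R]_(1 + n)).
split.
- apply: ord_headP => [|i]; first by rewrite row_mx_head normr_gt0.
  by rewrite row_mx_tail.
- rewrite big_ord_recl row_mx_head detEE; congr (_ * _).
  by rewrite -alphaE; apply: eq_bigr => i _; rewrite row_mx_tail.
(* Each elimination step at most doubles the entries, hence the power of 2. *)
- move=> M /EM [pM E'M].
  have M0 : 0 <= M by exact: le_trans pM.
  apply: ord_headP => [|i].
    by rewrite row_mx_head (le_trans pM) // ler_peMl // exprn_ege1 // ler1n.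
  by rewrite row_mx_tail (le_trans (alphaM _ E'M i)) // exprSr -mulrA mulr_natl.
- move=> a x0 aP.
  pose a0 := a ord0 ord0.
  have /andP[a0_gt0 a0p] : 0 < a0 <= `|p|.
    by have := aP ord0; rewrite row_mx_head.
  pose x00 := x0 ord0 ord0.
  (* The first coordinate is moved down to a multiple of [a0]; the remainder is less than [a0],
     itself at most [|p|], so that [t0] has absolute value at most 1. *)
  pose z0 := Num.floor (x00 / a0).
  pose t0 := - (x00 - a0 * z0%:~R) / p.
  have t01 : `|t0| <= 1.
    rewrite normrM normfV ler_pdivrMr ?normr_gt0 // mul1r (le_trans _ a0p) //.
    have := floor_le_tmp (x00 / a0); have := floorD1_gt (x00 / a0).
    rewrite -/z0 ltr_pdivrMr // ler_pdivlMr // intrD => h1 h2.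
    rewrite normrN ger0_norm; nra.
  (* The side effect of [t0] on the other coordinates goes into the base point, which is arbitrary
     in the induction hypothesis. *)
  pose x1 := rsubmx (x0 : 'rV_(1 + n)) + t0 *: u.
  have aP' i : 0 < rsubmx (a : 'rV_(1 + n)) ord0 i <= alpha ord0 i.
    by have := aP (lift ord0 i); rewrite row_mx_tail rsubmx_tail.
  have [t' [z' [t'K tz]]] := alphaZ (rsubmx (a : 'rV_(1 + n))) x1 aP'.
  have [t tK tEE] := tE K t0 t' (ltW K0) t'K.
  exists t, (fun i => if unlift ord0 i is Some k then z' k else z0).
  split=> [i|]; first by rewrite (le_trans (tK i)) // lerD2r.
  rewrite tEE; apply: ord_headP => [|i].
    rewrite mxE row_mx_head unlift_none -/x00 -/a0.
    by rewrite /t0 divfK // opprB addrC subrK.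
  have := tz i; rewrite rsubmx_tail liftK => <-.
  by rewrite mxE row_mx_tail /x1 -addrA [in RHS]mxE rsubmx_tail.
Qed.

(** * Volume of parallelepipeds and determinants *)

Definition box_wf (R : realType) d (b : 'rV[R]_d * 'rV[R]_d) : Prop :=
  forall i, b.1 ord0 i <= b.2 ord0 i.

Lemma box_volume_ge0 (R : realType) d (b : 'rV[R]_d * 'rV[R]_d) :
  box_wf b -> 0 <= box_volume b.
Proof. by move=> bwf; rewrite prodr_ge0 // => i _; rewrite subr_ge0. Qed.

Definition boxes_volume (R : realType) d (l : seq ('rV[R]_d * 'rV[R]_d)) : R :=
  \sum_(b <- l) box_volume b.

(* Slabs of thickness 1/N in the pivot direction p: for N large the shear by u
   inside a slab is absorbed by doubling the slice spanned by E'. *)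
Lemma parallelepiped_cover (R : realType) n : exists2 K : R, 0 < K &
  forall (T : 'M[R]_n) (x0 : 'rV[R]_n), \det T != 0 ->
  exists l : seq ('rV[R]_n * 'rV[R]_n),
   [/\ forall b, b \in l -> box_wf b,
       forall t : 'rV[R]_n, (forall i, `|t ord0 i| <= 1) ->
         exists2 b, b \in l & box b (x0 + t *m T) &
       boxes_volume l <= K * `|\det T|].
Proof.
elim: n => [|n [K K0 IH]].
  exists 1 => // T x0 _; exists [:: (0, 0)]; split.
  - by move=> b _ [].
  - by move=> t _; exists (0, 0); rewrite ?inE //; case.
  - by rewrite /boxes_volume big_seq1 /box_volume big_ord0 det_mx00 normr1 mulr1.
(* There are 2 (n + 1) N + 1 slabs of thickness |p| / N, and doubling [E'] multiplies its
   determinant by 2 ^ n. *)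
exists ((n.+1%:R *+ 2 + 1) * (2 ^+ n * K)).
  by rewrite mulr_gt0 ?addr_gt0 ?mulr_gt0 ?exprn_gt0 // pmulrn_rgt0.
move=> T x0 detT.
have [p [u [E' [p0 detEE _ _ tE]]]] := pivot_combinations detT.
have detE' : \det E' != 0.
  apply: contra_neq detT => d0; apply/eqP.
  by rewrite -normr_eq0 detEE d0 normr0 mulr0.
have E'unit : E' \in unitmx by rewrite unitmxE unitfE.
have det2E' : \det (2 *: E') != 0 by rewrite detZ mulf_neq0 // expf_neq0.
pose y0 := rsubmx (x0 : 'rV[R]_(1 + n)).
have [l' [l'wf l'cov l'vol]] := IH (2 *: E') y0 det2E'.
have [v uE] : exists v : 'rV[R]_n, u = v *m E'.
  by exists (u *m invmx E'); rewrite mulmxKV.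
(* With this [N], a remainder r <= 1 / N makes all entries of r v at most 1 in absolute value. *)
pose N := (Num.truncn (\sum_i `|v ord0 i|)).+1.
have vN i : `|v ord0 i| <= N%:R.
  rewrite (le_trans _ (ltW (truncnS_gt _))) // (bigD1 i) //= lerDl.
  by apply: sumr_ge0.
have N0 : 0 < N%:R :> R by rewrite ltr0n.
pose L := (n.+1 * N)%N.
have LE : L%:R = n.+1%:R * N%:R :> R by rewrite natrM.
pose q k : R := (k%:Z - L%:Z)%:~R / N%:R.
(* The minimum gives the lower end of the slab for either sign of [p]. *)
pose mk k (b : 'rV[R]_n * 'rV[R]_n) : 'rV[R]_n.+1 * 'rV[R]_n.+1 :=
  let m := x0 ord0 ord0 + q k * p + Num.min 0 (p / N%:R) in
  (row_mx m%:M (q k *: u + b.1), row_mx (m + `|p| / N%:R)%:M (q k *: u + b.2)).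
exists [seq mk k b | k <- iota 0 (L * 2).+1, b <- l']; split.
- move=> _ /allpairsP[[k b] [_ bl ->]] /=; apply: ord_headP => [|i].
    by rewrite /= !row_mx_head lerDl divr_ge0.
  by rewrite /= !row_mx_tail !mxE lerD2l; exact: l'wf.
- move=> t /tE[t0 [t' [t0n t'1 ->]]].
  pose k := Num.floor (t0 * N%:R).
  have kle : k%:~R <= t0 * N%:R by exact: floor_le_tmp.
  have kgt : t0 * N%:R < k%:~R + 1 by have := floorD1_gt (t0 * N%:R); rewrite intrD.
  have := t0n; rewrite ler_norml => /andP[t0l t0u].
  have kL0 : - L%:Z <= k.
    by rewrite floor_ge_int_tmp mulrNz -pmulrn LE -mulNr ler_wpM2r // ltW.
  have kL1 : k <= L%:Z.
    rewrite -(ler_int R) (le_trans kle) // -pmulrn LE.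
    by rewrite ler_wpM2r // ltW.
  pose j := absz (k + L%:Z).
  have jE : j%:Z = k + L%:Z by rewrite gez0_abs // -[leLHS](addNr L%:Z) lerD2r.
  have qj : q j = k%:~R / N%:R by rewrite /q jE addrK.
  pose r := t0 - q j.
  have r0 : 0 <= r by rewrite subr_ge0 qj ler_pdivrMr.
  have r1 : r * N%:R <= 1.
    by rewrite mulrBl qj divfK ?gt_eqF // lerBlDl; exact: ltW.
  have r2 : r <= N%:R^-1 by rewrite -[leRHS]mul1r ler_pdivlMr.
  (* The entries of r v + t' are at most 2 in absolute value; the halving matches the matrix
     [2 *: E']. *)
  pose w := 2^-1 *: (r *: v + t').
  have w1 i : `|w ord0 i| <= 1.
    rewrite !mxE normrM ger0_norm ?invr_ge0 // ler_pdivrMl // mulr1.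
    rewrite (le_trans (ler_normD _ _)) // lerD // normrM ger0_norm //.
    rewrite (le_trans _ r1) // ler_wpM2l //.
  have [b bl bw] := l'cov w w1.
  exists (mk j b).
    apply/allpairsP; exists (j, b); split => //.
    rewrite -[(j, b).1]/j mem_iota /= add0n ltnS -lez_nat jE muln2 -addnn PoszD.
    by rewrite lerD2r.
  have secE : t0 *: u + t' *m E' = q j *: u + w *m (2 *: E').
    rewrite -scalemxAr -scalemxAl scalerA divff // scale1r mulmxDl.
    by rewrite -scalemxAl -uE addrA -scalerDl /r addrCA subrr addr0.
  apply: ord_headP => [|i] /=.
    rewrite !row_mx_head [(x0 + _) _ _]mxE row_mx_head.
    have -> : t0 = q j + r by rewrite /r addrCA subrr addr0.
    have rp : r * `|p| <= `|p| / N%:R by rewrite mulrC ler_wpM2l.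
    have rp0 : 0 <= r * `|p| by rewrite mulr_ge0.
    have [pgt|plt] := ltrP 0 p.
      rewrite (gtr0_norm pgt) in rp rp0 *.
      rewrite min_l ?divr_ge0 ?(ltW pgt) //; lra.
    rewrite (ler0_norm plt) in rp rp0 *.
    rewrite min_r ?pmulr_lle0 ?invr_gt0 //; lra.
  have := bw i; rewrite !row_mx_tail secE [(x0 + _) _ _]mxE row_mx_tail.
  rewrite 3![(q j *: u + _) _ _]mxE.
  by rewrite [(y0 + _) _ _]mxE rsubmx_tail addrCA !lerD2l.
- rewrite /boxes_volume big_allpairs_dep.
  have volE k b : box_volume (mk k b) = `|p| / N%:R * box_volume b.
    rewrite /box_volume big_ord_recl /= !row_mx_head addrAC subrr add0r.
    congr (_ * _); apply: eq_bigr => i _; rewrite !row_mx_tail !mxE.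
    by rewrite opprD addrACA subrr add0r.
  under eq_bigr do under eq_bigr do rewrite volE.
  under eq_bigr do rewrite -mulr_sumr -/(boxes_volume l').
  rewrite big_const_seq count_predT size_iota iter_addr_0 -[leLHS]mulr_natl.
  rewrite -natr1 natrM LE detEE.
  have N1 : 1 <= N%:R :> R by rewrite ler1n.
  have l'V : boxes_volume l' <= K * (2 ^+ n * `|\det E'|).
    by rewrite (le_trans l'vol) // detZ normrM normrX normr_nat.
  have cle : (n.+1%:R * N%:R * 2 + 1) / N%:R <= n.+1%:R *+ 2 + 1 :> R.
    by rewrite ler_pdivrMr // mulrDl mul1r lerD // mulr2n; lra.
  have V0 : 0 <= boxes_volume l'.
    rewrite /boxes_volume big_seq sumr_ge0 // => b /l'wf bwf.
    exact: box_volume_ge0.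
  rewrite (@le_trans _ _ ((n.+1%:R *+ 2 + 1) * (`|p| * (K * (2 ^+ n * `|\det E'|))))) //; last first.
    by rewrite le_eqVlt; apply/orP; left; apply/eqP; ring.
  rewrite [X in X <= _](_ : _ = (n.+1%:R * N%:R * 2 + 1) / N%:R
    * (`|p| * boxes_volume l')); last by ring.
  by apply: ler_pM => //; [rewrite mulr_ge0 | rewrite ler_wpM2l].
Qed.

Lemma ler_sum_uniq_subset (R : numDomainType) (I : eqType) (s1 s2 : seq I) (F : I -> R) :
  uniq s1 -> uniq s2 -> {subset s1 <= s2} -> (forall i, 0 <= F i) ->
  \sum_(i <- s1) F i <= \sum_(i <- s2) F i.
Proof.
move=> u1 u2 s12 F0.
have p : perm_eq s1 [seq i <- s2 | i \in s1].
  apply: uniq_perm; rewrite ?filter_uniq // => i.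
  by rewrite mem_filter; apply/idP/andP => [i1|[]//]; split => //; exact: s12.
rewrite (perm_big _ p) big_filter [leRHS](bigID (mem s1)) /= lerDl.
exact: sumr_ge0.
Qed.

(** The lists are merged into one sequence through an encoding of pairs of naturals. A partial sum
    then involves finitely many lists, whose total volume is at most [B]. *)
Lemma volume_le_countable_cover (R : realType) d (A : set 'rV[R]_d.+1)
    (l : nat -> seq ('rV[R]_d.+1 * 'rV[R]_d.+1)) (B : R) :
  (forall k b, b \in l k -> box_wf b) ->
  (forall x, A x -> exists k, exists2 b, b \in l k & box b x) ->
  (forall N, \sum_(k < N) boxes_volume (l k) <= B) ->
  (volume A <= B%:E)%E.
Proof.
move=> lwf lcov lB.
(* Padding with a degenerate box is free: its volume is 0 in positive dimension. *)
pose z0 : 'rV[R]_d.+1 * 'rV[R]_d.+1 := (0, 0).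
pose F m := if @pickle_inv (nat * nat)%type m is Some kj then nth z0 (l kj.1) kj.2 else z0.
have Gwf k j : box_wf (nth z0 (l k) j).
  have [jl|lj] := ltnP j (size (l k)); first by apply: (lwf k); rewrite mem_nth.
  by rewrite nth_default // => i; rewrite /= lexx.
have Fwf m : box_wf (F m).
  by rewrite /F; case: pickle_inv => [kj|i]; [exact: Gwf | rewrite /= lexx].
have z0V : box_volume z0 = 0.
  by rewrite /box_volume big_ord_recl /= subrr mul0r.
apply: (@le_trans _ _ (\sum_(0 <= k <oo) (box_volume (F k))%:E)%E).
  apply: ereal_inf_lbound; exists F => //; split; first exact: Fwf.
  move=> x /lcov[k [b bl bx]]; exists (choice.pickle (k, index b (l k))) => //.
  by rewrite /F pickleK_inv /= nth_index.
apply: lime_le.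
  by apply: is_cvg_nneseries => m _ _; rewrite lee_fin; exact: box_volume_ge0.
apply: nearW => N; rewrite sumEFin lee_fin.
pose g (kj : nat * nat) := box_volume (nth z0 (l kj.1) kj.2).
have g0 kj : 0 <= g kj by exact: box_volume_ge0.
pose s := pmap (@pickle_inv (nat * nat)%type) (iota 0 N).
have -> : \sum_(0 <= i < N) box_volume (F i) = \sum_(kj <- s) g kj.
  rewrite /s /index_iota subn0; elim: (iota 0 N) => [|m r IH]; first by rewrite !big_nil.
  by rewrite big_cons IH /F /=; case: pickle_inv => [kj|] /=; rewrite ?big_cons ?z0V ?add0r.
have us : uniq s by rewrite (pmap_uniq (@pickle_invK _)) // iota_uniq.
pose P (kj : nat * nat) := (kj.2 < size (l kj.1))%N.
(* Every list reached by the first [N] terms has index below [K]. *)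
pose K := (\max_(kj <- s) kj.1).+1.
rewrite (bigID P) /= [X in _ + X]big1 ?addr0; last first.
  by move=> kj; rewrite /P -leqNgt => h; rewrite /g nth_default.
apply: le_trans (lB K); rewrite -big_filter.
pose s' := [seq (k, j) | k <- iota 0 K, j <- iota 0 (size (l k))].
apply: (@le_trans _ _ (\sum_(kj <- s') g kj)).
  apply: ler_sum_uniq_subset => //; first exact: filter_uniq.
    by apply: allpairs_uniq_dep => [||[a b] [a' b'] _ _ /= [-> ->]]; rewrite ?iota_uniq // => k _; rewrite iota_uniq.
  move=> [k j]; rewrite mem_filter /P /= => /andP[jl kjs].
  apply/allpairsPdep; exists k, j; rewrite !mem_iota /= !add0n jl ltnS; split => //.
  exact: (@leq_bigmax_seq _ _ xpredT (fun kj : nat * nat => kj.1) (k, j)).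
have iotaE n : iota 0 n = index_iota 0 n by rewrite /index_iota subn0.
rewrite big_allpairs_dep iotaE big_mkord; apply: ler_sum => k _.
by rewrite /boxes_volume (big_nth z0) iotaE.
Qed.

(** A linearly independent family in [D] of maximal size spans all of [D]. It has fewer than n
    members since the determinants vanish, so its cokernel has a nonzero column, which is orthogonal
    to [D]. *)
Lemma singular_rows_orthogonal (F : fieldType) n (D : set 'rV[F]_n) :
  (forall T : 'M[F]_n, (forall i, D (row i T)) -> \det T = 0) ->
  exists2 f : 'cV[F]_n, f != 0 & forall x, D x -> x *m f = 0.
Proof.
move=> Dsing.
pose P r := `[< exists2 B : 'M[F]_(r, n), row_free B & forall i, D (row i B) >].
have P0 : exists r, P r.
  exists 0%N; apply/asboolP; exists 0; last by case.
  by rewrite /row_free mxrank0.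
have Pn r : P r -> (r <= n)%N.
  by move=> /asboolP[B /eqP rB _]; rewrite -rB rank_leq_col.
case: (ex_maxnP P0 Pn) => r /asboolP[B rB BD] rmax.
have rn : (r < n)%N.
  rewrite ltn_neqAle Pn ?andbT; last by apply/asboolP; exists B.
  apply/eqP => e; subst r.
  by move: rB; rewrite row_free_unit unitmxE unitfE Dsing // eqxx.
have coker0 : cokermx B != 0.
  by rewrite -mxrank_eq0 mxrank_coker (eqP rB) -lt0n subn_gt0.
have [j fj] : exists j, col j (cokermx B) != 0.
  apply/existsP; apply: contraR coker0; rewrite negb_exists => /forallP h.
  apply/eqP/matrixP => a b; have /negPn/eqP/matrixP/(_ a ord0) := h b.
  by rewrite !mxE.
exists (col j (cokermx B)) => // x Dx.
have [|xB] := boolP (x <= B)%MS.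
  by rewrite submxE colE mulmxA => /eqP ->; rewrite mul0mx.
have : P (r + 1)%N.
  apply/asboolP; exists (col_mx B x).
    rewrite /row_free eqn_leq rank_leq_row /= -addsmxE addn1.
    rewrite -[X in (X < _)%N](eqP rB); apply: rank_ltmx.
    by rewrite /ltmx addsmxSl /= addsmx_sub submx_refl.
  move=> i; case: (split_ordP i) => k ->; first by rewrite rowKu.
  by rewrite rowKd row_id.
by move/rmax; rewrite addn1 ltnn.
Qed.

(** Cramer's rule: the coordinate is the quotient by [\det T] of the determinant in which [y]
    replaces row [i]. *)
Lemma norm_cramer_le (R : realFieldType) n (T : 'M[R]_n) (y : 'rV[R]_n) (s : R) i :
  T \in unitmx ->
  `|\det (\matrix_(a, b) if a == i then y ord0 b else T a b)| <= s ->
  `|(y *m invmx T) ord0 i| <= s / `|\det T|.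
Proof.
move=> Tu; set T' := \matrix_(a, b) _ => T's.
have detT : \det T != 0 by rewrite -unitfE -unitmxE.
have -> : (y *m invmx T) ord0 i = \det T' / \det T.
  rewrite /invmx Tu -scalemxAr mxE mulrC; congr (_ / _).
  (* The cofactors along row [i] do not see the replaced row. *)
  rewrite (expand_det_row T' i) mxE; apply: eq_bigr => b _; rewrite !mxE eqxx.
  congr (_ * _); rewrite /cofactor; congr (_ * \det _).
  by apply/matrixP => c e; rewrite !mxE eq_sym (negPf (neq_lift _ _)).
by rewrite normrM normfV ler_pM2r // invr_gt0 normr_gt0.
Qed.

(** A bounded piece of a hyperplane lies in a parallelepiped whose thickness across the hyperplane
    can be taken as small as desired. *)
Lemma hyperplane_slab_cover (R : realType) n (f : 'cV[R]_n.+1) (p0 : 'rV[R]_n.+1) (M eps : R) :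
  f != 0 -> 0 < M -> 0 < eps ->
  exists l : seq ('rV[R]_n.+1 * 'rV[R]_n.+1),
   [/\ forall b, b \in l -> box_wf b,
       forall y : 'rV[R]_n.+1, y *m f = 0 -> (forall i, `|y ord0 i| <= M) ->
         exists2 b, b \in l & box b (p0 + y) &
       boxes_volume l <= eps].
Proof.
move=> f0 M0 eps0.
have [j fj] : exists j, f j ord0 != 0.
  apply/existsP; apply: contraR f0; rewrite negb_exists => /forallP h.
  by apply/eqP/matrixP => a b; rewrite ord1 mxE; apply/eqP/negPn.
(* Change of coordinates putting the linear form [f] in place of coordinate [j]; it is invertible
   because [f j ord0] is nonzero. *)
pose G : 'M[R]_n.+1 := \matrix_(a, b) if b == j then f a ord0 else (a == b)%:R.
have yG (y : 'rV[R]_n.+1) b :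
    (y *m G) ord0 b = if b == j then (y *m f) ord0 ord0 else y ord0 b.
  rewrite !mxE; have [->|bj] := eqVneq b j.
    by apply: eq_bigr => a _; rewrite mxE eqxx.
  rewrite (bigD1 b) //= mxE (negPf bj) eqxx mulr1 big1 ?addr0 // => a ab.
  by rewrite mxE (negPf bj) (negPf ab) mulr0.
have Gu : G \in unitmx.
  rewrite unitmxE unitfE; apply/det0P => -[v v0 vG]; move/negP: v0; apply; apply/eqP.
  have vb b : b != j -> v ord0 b = 0.
    by move=> bj; have := yG v b; rewrite (negPf bj) vG mxE.
  apply/rowP => b; rewrite mxE; have [->|/vb//] := eqVneq b j.
  have := yG v j; rewrite eqxx vG !mxE (bigD1 j) //= big1 => [|a /vb ->]; last by rewrite mul0r.
  by move/esym/eqP; rewrite addr0 mulf_eq0 (negPf fj) orbF => /eqP.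
have detG : \det (invmx G) != 0 by rewrite -unitfE -unitmxE unitmx_inv.
have [K K0 cov] := parallelepiped_cover R n.+1.
pose c := K * (M ^+ n * `|\det (invmx G)|).
have c0 : 0 < c by rewrite !mulr_gt0 ?exprn_gt0 // normr_gt0.
(* This thickness makes the bound of [parallelepiped_cover] equal to [eps]. *)
pose del := eps / c.
have del0 : 0 < del by rewrite divr_gt0.
pose v : 'rV[R]_n.+1 := \row_i if i == j then del else M.
have v0 i : 0 < v ord0 i by rewrite mxE; case: ifP.
pose T := diag_mx v *m invmx G.
have detT : `|\det T| = del * M ^+ n * `|\det (invmx G)|.
  rewrite det_mulmx normrM det_diag; congr (_ * _).
  rewrite normr_prod (bigD1 j) //= gtr0_norm // mxE eqxx; congr (_ * _).
  rewrite (eq_bigr (fun=> M)) => [|i ij]; last by rewrite gtr0_norm // mxE (negPf ij).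
  by rewrite prodr_const cardC1 card_ord.
have detT0 : \det T != 0.
  by rewrite -normr_gt0 detT mulr_gt0 ?normr_gt0 // mulr_gt0 ?exprn_gt0.
have [l [lwf lcov lvol]] := cov T p0 detT0.
exists l; split => // [y yf yM|]; last first.
  rewrite (le_trans lvol) // detT.
  have -> : K * (del * M ^+ n * `|\det (invmx G)|) = del * c by rewrite /c; ring.
  by rewrite divfK // gt_eqF.
pose t : 'rV[R]_n.+1 := \row_i ((y *m G) ord0 i / v ord0 i).
have t1 i : `|t ord0 i| <= 1.
  rewrite mxE yG normrM normfV [ `|v _ _|]gtr0_norm // ler_pdivrMr // mul1r.
  case: ifP => ij; first by rewrite yf mxE normr0 ltW.
  by rewrite mxE ij yM.
have [b bl bt] := lcov t t1; exists b => //.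
suff -> : y = t *m T by [].
rewrite /T mulmxA.
have -> : t *m diag_mx v = y *m G.
  by apply/rowP => i; rewrite mul_mx_diag mxE mxE divfK // gt_eqF.
by rewrite -mulmxA mulmxV // mulmx1.
Qed.

(* If the determinants do not all vanish, Cramer's rule for T of nearly maximal
   determinant puts A in the parallelepiped p0 + [-2, 2]^(n+1) T; otherwise A
   lies in a hyperplane. *)
Lemma volume_le_det (R : realType) n : exists2 K : R, 0 < K &
  forall (A : set 'rV[R]_n.+1) (p0 : 'rV[R]_n.+1) (s : R), 0 < s ->
    (forall T : 'M[R]_n.+1, (forall i, A (p0 + row i T)) -> `|\det T| <= s) ->
    (volume A <= (K * s)%:E)%E.
Proof.
have [K K0 cov] := parallelepiped_cover R n.+1.
exists (2 ^+ n.+1 * K); first by rewrite mulr_gt0 ?exprn_gt0.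
move=> A p0 s s0 As.
have Ks0 : 0 < 2 ^+ n.+1 * K * s by rewrite !mulr_gt0 ?exprn_gt0.
pose D := [set `|\det T| | T in [set T : 'M[R]_n.+1 | forall i, A (p0 + row i T)]].
have [[T0 T0A detT0]|nondeg] :=
    pselect (exists2 T : 'M[R]_n.+1, forall i, A (p0 + row i T) & \det T != 0).
  have Dsup : has_sup D.
    split; first by exists `|\det T0|; exists T0.
    by exists s => _ [T TA <-]; exact: As.
  have S0 : 0 < sup D.
    apply: lt_le_trans (_ : 0 < `|\det T0|) _; first by rewrite normr_gt0.
    by apply: sup_upper_bound => //; exists T0.
  have S20 : 0 < sup D / 2 by rewrite divr_gt0.
  have [_ [T TA <-] TS] := sup_adherent S20 Dsup.
  have detT : 0 < `|\det T| by apply: le_lt_trans TS; lra.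
  have Tu : T \in unitmx by rewrite unitmxE unitfE -normr_gt0.
  have det2T : \det (2 *: T) != 0.
    by rewrite detZ mulf_neq0 ?expf_neq0 // -normr_gt0.
  have [l [lwf lcov lvol]] := cov _ p0 det2T.
  apply: (@volume_le_countable_cover _ _ _ (fun k => if k == 0%N then l else [::])).
  - by move=> k b; case: eqP => // _; exact: lwf.
  - move=> x Ax; exists 0%N; rewrite eqxx; pose y := x - p0.
    have xE : x = p0 + y by rewrite /y addrCA subrr addr0.
    pose t := 2^-1 *: (y *m invmx T).
    have t1 i : `|t ord0 i| <= 1.
      rewrite mxE normrM ger0_norm ?invr_ge0 // ler_pdivrMl // mulr1.
      apply: (@le_trans _ _ (sup D / `|\det T|)).
        apply: norm_cramer_le => //; apply: sup_upper_bound => //.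
        eexists; last reflexivity.
        move=> a; have [ai|ai] := eqVneq a i.
          suff -> : row a (\matrix_(a, b) if a == i then y ord0 b else T a b) = y.
            by rewrite -xE.
          by apply/rowP => b; rewrite !mxE ai eqxx.
        suff -> : row a (\matrix_(a, b) if a == i then y ord0 b else T a b) = row a T.
          exact: TA.
        by apply/rowP => b; rewrite !mxE (negPf ai).
      by rewrite ler_pdivrMr //; lra.
    have [b bl bt] := lcov t t1; exists b => //.
    suff tTE : t *m (2 *: T) = y by rewrite xE -tTE.
    by rewrite -scalemxAr -scalemxAl scalerA divff // scale1r mulmxKV.
  - case=> [|N]; first by rewrite big_ord0 ltW.
    rewrite big_ord_recl eqxx big1 => [|i _]; last by rewrite /boxes_volume big_nil.
    rewrite addr0 (le_trans lvol) // detZ normrM normrX normr_nat mulrA.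
    by rewrite ler_pM ?mulr_ge0 ?(ltW K0) // ?As // [leRHS]mulrC.
have [f f0 fA] : exists2 f : 'cV[R]_n.+1, f != 0 & forall y, A (p0 + y) -> y *m f = 0.
  apply: singular_rows_orthogonal => T TA; apply/eqP/negPn/negP => T0.
  by apply: nondeg; exists T.
(* The k-th list covers the part of the hyperplane at sup distance at most k + 1 from [p0]; the
   volumes are bounded by a geometric series. *)
have slab k : exists l : seq ('rV[R]_n.+1 * 'rV[R]_n.+1),
   [/\ forall b, b \in l -> box_wf b,
       forall y : 'rV[R]_n.+1, y *m f = 0 -> (forall i, `|y ord0 i| <= k.+1%:R) ->
         exists2 b, b \in l & box b (p0 + y) &
       boxes_volume l <= 2 ^+ n.+1 * K * s / 2 ^+ k.+1].
  by apply: hyperplane_slab_cover => //; rewrite divr_gt0 // exprn_gt0.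
have [l lP] := choice slab.
apply: (@volume_le_countable_cover _ _ _ l).
- by move=> k b; case: (lP k) => lwf _ _; exact: lwf.
- move=> x Ax; pose y := x - p0.
  have xE : x = p0 + y by rewrite /y addrCA subrr addr0.
  pose k := Num.truncn (\sum_i `|y ord0 i|).
  have yk i : `|y ord0 i| <= k.+1%:R.
    rewrite (le_trans _ (ltW (truncnS_gt _))) // (bigD1 i) //= lerDl.
    by apply: sumr_ge0.
  exists k; have [_ lcov _] := lP k; rewrite xE; apply: lcov => //.
  by apply: fA; rewrite -xE.
- move=> N.
  have geo : \sum_(k < N) (2 ^+ k.+1)^-1 = 1 - (2 ^+ N)^-1 :> R.
    elim: N => [|N IH]; first by rewrite big_ord0 expr0 invr1 subrr.
    rewrite big_ord_recr /= IH exprS invfM; lra.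
  apply: (@le_trans _ _ (\sum_(k < N) 2 ^+ n.+1 * K * s / 2 ^+ k.+1)).
    by apply: ler_sum => k _; have [] := lP k.
  by rewrite -mulr_sumr geo ler_piMr ?ltW // lerBlDr lerDl invr_ge0 exprn_ge0.
Qed.

(** * The union of lattices meets large convex sets *)

Lemma convex_setP (R : realType) d (C : set 'rV[R]_d) :
  convex_set C <-> forall (x y : 'rV[R]_d) (t : R), C x -> C y -> 0 <= t -> t <= 1 ->
    C (t *: x + (1 - t) *: y).
Proof.
split=> [cC x y t Cx Cy t0 t1|cC x y t].
  have := cC x y (Itv01 t0 t1) (mem_set Cx) (mem_set Cy).
  by move=> /set_mem.
by move=> /set_mem Cx /set_mem Cy; apply/mem_set; exact: cC.
Qed.

(** The weight missing to reach 1 is carried by [p0]. The induction divides the later weights by 1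
    minus the first one; when the first weight is 1, the others vanish. *)
Lemma convex_combination (R : realType) d n (C : set 'rV[R]_d) (p0 : 'rV[R]_d)
    (q : 'I_n -> 'rV[R]_d) (s : 'I_n -> R) :
  convex_set C -> C p0 -> (forall i, C (p0 + q i)) ->
  (forall i, 0 <= s i) -> \sum_i s i <= 1 ->
  C (p0 + \sum_i s i *: q i).
Proof.
move=> /convex_setP cC Cp0; elim: n q s => [|n IH] q s Cq s0.
  by rewrite !big_ord0 addr0.
rewrite !big_ord_recl => s1.
have sr0 : 0 <= \sum_(i < n) s (lift ord0 i) by exact: sumr_ge0.
have [e|ne] := eqVneq (s ord0) 1.
  have sr : \sum_(i < n) s (lift ord0 i) = 0.
    by apply/eqP; rewrite eq_le sr0 andbT; move: s1; rewrite e; lra.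
  rewrite e scale1r [X in _ + (_ + X)]big1 ?addr0 // => i _.
  by rewrite (psumr_eq0P _ sr) ?scale0r // => k _; exact: s0.
have lt1 : 0 < 1 - s ord0 by rewrite subr_gt0 lt_neqAle ne; lra.
pose s' i := s (lift ord0 i) / (1 - s ord0).
have Cr : C (p0 + \sum_(i < n) s' i *: q (lift ord0 i)).
  apply: IH => [i|i|]; [exact: Cq | by rewrite divr_ge0 // ltW |].
  by rewrite /s' -mulr_suml ler_pdivrMr // mul1r; lra.
have := cC _ _ (s ord0) (Cq ord0) Cr (s0 ord0); have -> : s ord0 <= 1 by lra.
move/(_ isT); congr (C _).
have s01 : s ord0 + (1 - s ord0) = 1 by ring.
rewrite !scalerDr addrACA -scalerDl s01 scale1r; congr (_ + (_ + _)).
rewrite scaler_sumr; apply: eq_bigr => i _.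
by rewrite scalerA /s' mulrC divfK // gt_eqF.
Qed.

Definition diag_scale (R : realType) n (A : R) (z : 'rV[int]_n) : 'rV[R]_n.+1 :=
  row_mx (A / \prod_k expR (z ord0 k)%:~R)%:M (\row_k expR (z ord0 k)%:~R).

(* The last condition only retains near x the lattices which are not much
   coarser than |x|; it is what makes the set sparse. *)
Definition lattice_union (R : realType) n (A : R) : set 'rV[R]_n.+1 :=
  [set x | exists z : 'rV[int]_n,
    (forall i, exists m : int, x ord0 i = diag_scale A z ord0 i * m%:~R) /\
    exists j, forall i, diag_scale A z ord0 i <= 2 ^+ n.+2 * `|x ord0 j|].

Lemma diag_scale_gt0 (R : realType) n (A : R) (z : 'rV[int]_n) i :
  0 < A -> 0 < diag_scale A z ord0 i.
Proof.
move=> A0; move: i; apply: ord_headP => [|i].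
  by rewrite row_mx_head divr_gt0 // prodr_gt0 // => k _; exact: expR_gt0.
by rewrite row_mx_tail mxE expR_gt0.
Qed.

Lemma prod_diag_scale (R : realType) n (A : R) (z : 'rV[int]_n) :
  \prod_i diag_scale A z ord0 i = A.
Proof.
rewrite big_ord_recl row_mx_head.
under [X in _ * X]eq_bigr do rewrite row_mx_tail mxE.
by rewrite divfK // gt_eqF // prodr_gt0 // => k _; exact: expR_gt0.
Qed.

(** Rounding the logarithms of the last n entries down to integers loses a factor at most e for
    each. The factor e ^ n in the hypothesis pays for this, so that the first entry, fixed by the
    determinant, fits too. *)
Lemma diag_scale_approx (R : realType) n (A : R) (alpha : 'rV[R]_n.+1) :
  0 < A -> (forall i, 0 < alpha ord0 i) ->
  A * expR 1 ^+ n <= \prod_i alpha ord0 i ->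
  exists z : 'rV[int]_n, forall i, diag_scale A z ord0 i <= alpha ord0 i.
Proof.
move=> A0 alpha0 Aal.
exists (\row_k Num.floor (ln (alpha ord0 (lift ord0 k)))).
apply: ord_headP => [|k]; last first.
  rewrite row_mx_tail !mxE -[leRHS]lnK ?ler_expR ?floor_le_tmp //.
  by rewrite posrE.
rewrite row_mx_head ler_pdivrMr ?prodr_gt0 //.
rewrite -(ler_pM2r (exprn_gt0 n (expR_gt0 1))) (le_trans Aal) //.
rewrite big_ord_recl -mulrA ler_pM2l //.
have -> : expR 1 ^+ n = \prod_(k < n) expR 1 :> R by rewrite prodr_const card_ord.
rewrite -big_split /=.
apply: ler_prod => k _; rewrite ltW //= !mxE -expRD.
rewrite -[leLHS]lnK ?ler_expR ?posrE // ltW //.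
by have := floorD1_gt (ln (alpha ord0 (lift ord0 k))); rewrite intrD.
Qed.

Lemma convex_meets_lattice_union (R : realType) n (A : R) : 0 < A ->
  exists2 s : R, 0 < s & forall (C : set 'rV[R]_n.+1) p0 (T : 'M[R]_n.+1),
    convex_set C -> C p0 -> (forall i, C (p0 + row i T)) -> s < `|\det T| ->
    C `&` lattice_union A !=set0.
Proof.
move=> A0.
have [K K0 KP] := parallelepiped_meets_lattice R n.+1.
(* Weights all equal to [sg] can each be perturbed by up to [sg] and remain nonnegative with sum at
   most 1. *)
pose sg : R := (n.+1%:R *+ 2)^-1.
have sg0 : 0 < sg by rewrite invr_gt0 pmulrn_rgt0.
(* The 4 comes from the homothety of ratio 1/4; with K + 1, coefficients bounded by [K] perturb the
   weights by at most [sg]. *)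
pose ka := sg / (4 * (K + 1)).
have ka0 : 0 < ka by rewrite divr_gt0 // mulr_gt0 // addr_gt0.
(* Beyond this threshold the determinant of [ka *: T] exceeds A e ^ n, as [diag_scale_approx]
   requires. *)
exists (A * expR 1 ^+ n / ka ^+ n.+1).
  by rewrite divr_gt0 ?exprn_gt0 // mulr_gt0 ?exprn_gt0 ?expR_gt0.
move=> C p0 T cC Cp0 CT sT.
have detT0 : 0 < `|\det T|.
  by apply: lt_trans sT; rewrite divr_gt0 ?exprn_gt0 // mulr_gt0 ?exprn_gt0 ?expR_gt0.
pose V (o : option 'I_n.+1) := if o is Some i then p0 + row i T else p0.
(* A vertex of the simplex of largest sup norm, with a coordinate attaining it. *)
pose w := [arg max_(w > (None, ord0) : option 'I_n.+1 * 'I_n.+1) `|V w.1 ord0 w.2|]%O.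
pose p := V w.1; pose c := w.2; pose M := `|p ord0 c|.
have VM o e : `|V o ord0 e| <= M.
  rewrite /M /p /c /w; case: Order.TotalTheory.arg_maxP => // k _ h.
  exact: (h (o, e)).
have Cp : C p by rewrite /p; case: w.1.
have TM a b : `|T a b| <= 2 * M.
  have -> : T a b = V (Some a) ord0 b - V None ord0 b by rewrite /= !mxE addrAC subrr add0r.
  by rewrite (le_trans (ler_normB _ _)) // mulr_natl mulr2n lerD.
have M0 : 0 < M.
  rewrite lt_neqAle normr_ge0 andbT; apply/eqP => M0; move: detT0.
  suff -> : T = 0 by rewrite det0 normr0 ltxx.
  apply/matrixP => a b; rewrite mxE; apply/eqP; rewrite -normr_le0.
  by rewrite (le_trans (TM a b)) // -M0 mulr0.
(* For |t| <= K the point x0 + t *m E is (y + 3 p) / 4 with y in the simplex. *)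
pose E := ka *: T.
have detE : `|\det E| = ka ^+ n.+1 * `|\det T|.
  by rewrite detZ normrM gtr0_norm // exprn_gt0.
have detE0 : \det E != 0 by rewrite -normr_gt0 detE mulr_gt0 // exprn_gt0.
have [alpha [alpha0 alphaE alphaM alphaZ]] := KP E detE0.
have [z zalpha] : exists z : 'rV[int]_n, forall i, diag_scale A z ord0 i <= alpha ord0 i.
  apply: diag_scale_approx => //; rewrite alphaE detE [leRHS]mulrC.
  by rewrite -ler_pdivrMr ?exprn_gt0 // ltW.
pose x0 := 4^-1 *: (p0 + const_mx sg *m T) + (3 / 4) *: p.
have [|t [m [tK xm]]] := alphaZ (diag_scale A z) x0.
  by move=> i; rewrite diag_scale_gt0 // zalpha.
pose st : 'rV[R]_n.+1 := \row_i (sg + sg / (K + 1) * t ord0 i).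
have K10 : 0 < K + 1 by rewrite addr_gt0.
have tb i : `|sg / (K + 1) * t ord0 i| <= sg.
  rewrite -mulrA normrM (gtr0_norm sg0) ler_piMr ?(ltW sg0) //.
  rewrite mulrC normrM normfV (gtr0_norm K10) ler_pdivrMr // mul1r.
  by rewrite (le_trans (tK i)) // lerDl.
have st0 i : 0 <= st ord0 i.
  by rewrite mxE; have := tb i; rewrite ler_norml => /andP[]; lra.
have st1 : \sum_i st ord0 i <= 1.
  apply: (@le_trans _ _ (\sum_(i < n.+1) sg *+ 2)).
    apply: ler_sum => i _; rewrite mxE mulr2n lerD2l.
    by have := tb i; rewrite ler_norml => /andP[].
  have -> : sg *+ 2 = n.+1%:R^-1.
    have : n.+1%:R != 0 :> R by rewrite pnatr_eq0.
    by rewrite /sg; move: (n.+1%:R : R) => a a0; field.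
  by rewrite sumr_const card_ord -[leLHS]mulr_natl divff // pnatr_eq0.
pose y := p0 + st *m T.
have yin (C' : set 'rV[R]_n.+1) : convex_set C' -> (forall o, C' (V o)) -> C' y.
  move=> cC' C'V; rewrite /y mulmx_sum_row.
  by apply: convex_combination => // [|i]; [exact: (C'V None) | exact: (C'V (Some i))].
have Cy : C y by apply: yin => // -[].
have yM : `|y ord0 c| <= M.
  (* This slab is convex and contains all the vertices. *)
  apply: (yin [set v | `|v ord0 c| <= M]) => [|o]; last exact: VM.
  apply/convex_setP => u v l /= uM vM l0 l1; rewrite !mxE.
  rewrite (le_trans (ler_normD _ _)) // !normrM (ger0_norm l0) [ `|1 - l|]ger0_norm ?subr_ge0 //.
  have : l * `|u ord0 c| <= l * M by rewrite ler_wpM2l.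
  have : (1 - l) * `|v ord0 c| <= (1 - l) * M by rewrite ler_wpM2l ?subr_ge0.
  lra.
pose x := x0 + t *m E.
have xy : x = 4^-1 *: y + (1 - 4^-1) *: p.
  rewrite /x /x0 /y /E.
  have -> : st = const_mx sg + (sg / (K + 1)) *: t by apply/rowP => i; rewrite !mxE.
  have -> : 3 / 4 = 1 - 4^-1 :> R by lra.
  rewrite mulmxDl -scalemxAl -scalemxAr !scalerDr scalerA.
  have -> : ka = 4^-1 * (sg / (K + 1)) by rewrite /ka invfM; ring.
  by rewrite -!addrA; congr (_ + (_ + _)); rewrite addrC.
have Cx : C x by rewrite xy; move/convex_setP: cC; apply => //; lra.
(* Since |p_c| = M and |y_c| <= M, |x_c| is at least 3 M / 4 - M / 4. *)
have xc : M / 2 <= `|x ord0 c|.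
  rewrite xy [(4^-1 *: y + _) _ _]mxE [(_ *: y) _ _]mxE [(_ *: p) _ _]mxE.
  have h : `|p ord0 c| = M by [].
  have := ler_normD (4^-1 * y ord0 c + (1 - 4^-1) * p ord0 c) (- (4^-1 * y ord0 c)).
  rewrite addrAC subrr add0r normrN !normrM h.
  have -> : `|1 - 4^-1| = 1 - 4^-1 :> R by rewrite ger0_norm //; lra.
  have -> : `|4^-1| = 4^-1 :> R by rewrite ger0_norm //; lra.
  lra.
exists x; split => //; exists z; split; first by move=> i; exists (m i); exact: xm.
(* The entries of [E] are at most 2 ka M <= M, so each alpha_i is at most 2 ^ (n + 1) M, which is at
   most 2 ^ (n + 2) |x_c|. *)
exists c => i; rewrite (le_trans (zalpha i)) // (le_trans (alphaM M _ i)) //.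
  move=> a b; rewrite mxE normrM (gtr0_norm ka0).
  apply: (@le_trans _ _ (ka * (2 * M))); first by rewrite ler_wpM2l // ltW.
  rewrite mulrA ler_piMl ?(ltW M0) // -ler_pdivlMr // mul1r /ka.
  have sg1 : sg <= 1 by rewrite /sg invf_le1 ?pmulrn_rgt0 // -mulrnA ler1n muln_gt0.
  by rewrite ler_pdivrMr ?mulr_gt0 //; nra.
rewrite [in leRHS]exprSr -mulrA ler_wpM2l ?exprn_ge0 //; lra.
Qed.

(** A point x lies in C + U exactly when x - C meets U, and x - C contains the reflected simplex,
    whose determinant is the same up to sign. By [volume_le_det], large volume forces a simplex of
    large determinant. *)
Lemma lattice_union_universal (R : realType) n (A : R) : 0 < A ->
  universal_convex_covering (@lattice_union R n A).
Proof.
move=> A0; have [s s0 sP] := @convex_meets_lattice_union R n A A0.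
have [K K0 KP] := volume_le_det R n.
exists (K * s); first exact: mulr_gt0.
move=> C cC Cvol.
have big p0 : exists2 T : 'M[R]_n.+1, forall i, C (p0 + row i T) & s < `|\det T|.
  apply: contrapT => h; move: Cvol; rewrite ltNge => /negP; apply.
  apply: (KP C p0) => // T TC; rewrite leNgt; apply/negP => sT; apply: h.
  by exists T.
(* With base point 0, which may lie outside [C], any row of [T] is a point of [C]; it becomes the
   actual base point. *)
have [p0 Cp0] : exists p0, C p0.
  have [T TC _] := big 0; exists (0 + row ord0 T); exact: TC.
have [T TC sT] := big p0.
apply/seteqP; split => // x _.
have [] := sP [set x - p | p in C] (x - p0) (- T).
- apply/convex_setP => _ _ t [a Ca <-] [b Cb <-] t0 t1.
  exists (t *: a + (1 - t) *: b); first by move/convex_setP: cC; apply.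
  have t1' : t + (1 - t) = 1 by ring.
  by rewrite !scalerBr addrACA -scalerDl t1' scale1r opprD.
- by exists p0.
- move=> i; exists (p0 + row i T); first exact: TC.
  by rewrite opprD addrA; congr (_ + _); apply/rowP => j; rewrite !mxE.
- by rewrite -scaleN1r detZ normrM normrX normrN1 expr1n mul1r.
move=> _ [[p Cp <-] pU]; exists p => //; exists (x - p) => //.
by rewrite addrCA subrr addr0.
Qed.

(** * Counting points *)

Lemma counting_le_size (R : realType) (T : choiceType) (S : set T) (s : seq T) :
  (forall x, S x -> x \in s) -> (counting S <= ((size s)%:R : R)%:E)%E.
Proof.
move=> Ss; have Sfin : finite_set S.
  by apply: (@sub_finite_set _ _ [set` s]) => [x /Ss|]; [|exact: finite_seq].
rewrite /counting asboolT // lee_fin ler_nat.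
apply: uniq_leq_size => [|x]; first exact: fset_uniq.
by rewrite -[_ \in _]/(x \in fset_set S) in_fset_set // => /set_mem/Ss.
Qed.

Lemma le_size_counting (R : realType) (T : choiceType) (S : set T) (s : seq T) :
  uniq s -> (forall x, x \in s -> S x) -> (((size s)%:R : R)%:E <= counting S)%E.
Proof.
move=> us sS; rewrite /counting; case: ifPn => [/asboolP Sfin|_]; last exact: leey.
rewrite lee_fin ler_nat.
apply: uniq_leq_size => // x /sS Sx.
by rewrite -[_ \in _]/(x \in fset_set S) in_fset_set //; exact: mem_set.
Qed.

Lemma row_enumeration (R : pzRingType) n (l : 'I_n -> seq R) :
  exists2 s : seq 'rV[R]_n,
    forall x : 'rV[R]_n, (forall i, x ord0 i \in l i) -> x \in s &
    size s = (\prod_i size (l i))%N.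
Proof.
elim: n l => [|n IH] l.
  exists [:: 0]; last by rewrite big_ord0.
  by move=> x _; rewrite inE; apply/eqP/rowP; case.
have [s sP ss] := IH (fun i => l (lift ord0 i)).
exists [seq (row_mx t%:M v : 'rV[R]_n.+1) | t <- l ord0, v <- s]; last first.
  by rewrite size_allpairs ss big_ord_recl.
move=> x xl; apply/allpairsP; exists (x ord0 ord0, \row_i x ord0 (lift ord0 i)).
split => //=; first by apply: sP => i; rewrite mxE.
apply/rowP; apply: ord_headP => [|i]; first by rewrite row_mx_head.
by rewrite row_mx_tail mxE.
Qed.

Lemma int_interval_enumeration (R : realType) (a b : R) : a <= b ->
  exists2 l : seq int, forall m : int, a <= m%:~R <= b -> m \in l &
    (size l)%:R <= b - a + 1.
Proof.
move=> ab; pose N := Num.truncn (b - a).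
have ba0 : 0 <= b - a by rewrite subr_ge0.
exists [seq Num.ceil a + j%:Z | j <- iota 0 N.+1].
  move=> m /andP[am mb].
  have cm : Num.ceil a <= m by rewrite ceil_le_int_tmp.
  apply/mapP; exists (absz (m - Num.ceil a)); last first.
    by rewrite gez0_abs ?subr_ge0 // addrCA subrr addr0.
  rewrite mem_iota /= add0n ltnS truncn_ge_nat // natr_absz ger0_norm ?subr_ge0 //.
  by rewrite intrB lerB // ceil_ge.
by rewrite size_map size_iota -natr1 lerD2r truncn_le.
Qed.

(** At most 2 r / a_i + 1 multiples of a_i lie in [-r, r], and a_i <= X bounds this by (2 r + X) /
    a_i. *)
Lemma lattice_ball_enumeration (R : realType) n (a : 'I_n -> R) (r X : R) :
  0 <= r -> (forall i, 0 < a i <= X) ->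
  exists2 s : seq 'rV[R]_n,
    forall x : 'rV[R]_n, (forall i, `|x ord0 i| <= r) ->
      (forall i, exists m : int, x ord0 i = a i * m%:~R) -> x \in s &
    (size s)%:R <= (2 * r + X) ^+ n / \prod_i a i.
Proof.
move=> r0 aX.
have /choice[l lP] i : exists l : seq R,
    (forall m : int, `|a i * m%:~R| <= r -> a i * m%:~R \in l) /\
    (size l)%:R <= (2 * r + X) / a i.
  have /andP[a0 aXi] := aX i.
  have [|l lP ls] := @int_interval_enumeration R (- (r / a i)) (r / a i).
    by rewrite ge0_cp // divr_ge0 // ltW.
  exists [seq a i * m%:~R | m <- l]; split.
    move=> m; rewrite normrM gtr0_norm // mulrC -ler_pdivlMr // => h.
    by apply/mapP; exists m => //; apply: lP; rewrite -ler_norml.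
  rewrite size_map (le_trans ls) // ler_pdivlMr // !mulrDl opprK mul1r divfK ?gt_eqF //.
  lra.
have [s sP ss] := row_enumeration l; exists s.
  move=> x xr xm; apply: sP => i; have [m xi] := xm i; rewrite xi.
  by have [h _] := lP i; apply: h; rewrite -xi.
rewrite ss natr_prod -prodfV.
have -> : (2 * r + X) ^+ n = \prod_(i < n) (2 * r + X) by rewrite prodr_const card_ord.
rewrite -big_split /=.
by apply: ler_prod => i _; rewrite ler0n; have [_] := lP i.
Qed.

Lemma size_flatten_le (R : realDomainType) (I : Type) (T : Type) (s : seq I) (f : I -> seq T) (B : R) :
  (forall i, (size (f i))%:R <= B) ->
  (size [seq x | i <- s, x <- f i])%:R <= (size s)%:R * B.
Proof.
move=> fB; elim: s => [|i s IH]; first by rewrite mul0r.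
by rewrite /= size_cat size_map natrD -natr1 mulrDl mul1r addrC lerD.
Qed.

Lemma le_enorm (R : realType) d (x : 'rV[R]_d) i : `|x ord0 i| <= enorm x.
Proof.
rewrite /enorm -sqrtr_sqr ler_sqrt ?sumr_ge0 // => [|k _]; last exact: sqr_ge0.
by rewrite (bigD1 i) //= lerDl sumr_ge0 // => k _; exact: sqr_ge0.
Qed.

(** A lattice contributing to the ball has all its scales at most [X], so each of its n exponents
    lies between -n ln X and ln X. The first factor counts these exponents, the second the points of
    one lattice. *)
Lemma lattice_union_ball_enumeration (R : realType) n (A r X : R) :
  1 <= A -> 1 <= r -> X = 2 ^+ n.+2 * r ->
  (counting (@lattice_union R n A `&` eball n.+1 r) <=
    ((n.+1%:R * ln X + 1) ^+ n * ((2 * r + X) ^+ n.+1 / A))%:E)%E.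
Proof.
move=> A1 r1 XE.
have A0 : 0 < A by rewrite (lt_le_trans _ A1).
have r0 : 0 < r by rewrite (lt_le_trans _ r1).
have X1 : 1 <= X by rewrite XE -[leLHS]mul1r ler_pM // exprn_ege1 // ler1n.
have X0 : 0 < X by rewrite (lt_le_trans _ X1).
have lnX0 : 0 <= ln X by rewrite ln_ge0.
pose adm (z : 'rV[int]_n) := forall i, diag_scale A z ord0 i <= X.
have [|lz lzP lzs] := @int_interval_enumeration R (- (n%:R * ln X)) (ln X).
  by rewrite (le_trans _ lnX0) // oppr_le0 mulr_ge0.
have [sz szP szs] := row_enumeration (fun _ : 'I_n => lz).
have zbound z : adm z -> z \in sz.
  move=> zX; apply: szP => k; apply: lzP.
  have ek := zX (lift ord0 k); rewrite row_mx_tail mxE in ek.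
  have e0 := expR_gt0 (z ord0 k)%:~R : 0 < _ :> R.
  apply/andP; split; last first.
    by rewrite -ler_expR lnK // posrE.
  (* The product of the scales is A >= 1 and each one is at most X. *)
  rewrite -ler_expR expRN expRM_natl lnK ?posrE //.
  rewrite -[leLHS]mul1r ler_pdivrMr ?exprn_gt0 // (le_trans A1) //.
  rewrite -(prod_diag_scale A z) (bigD1 (lift ord0 k)) //= row_mx_tail mxE.
  rewrite ler_pM2l //.
  apply: (@le_trans _ _ (\prod_(i < n.+1 | i != lift ord0 k) X)).
    by apply: ler_prod => i _; rewrite ltW ?diag_scale_gt0 //=; exact: zX.
  by rewrite prodr_const cardC1 card_ord.
have /choice[f fP] (z : 'rV[int]_n) : exists s : seq 'rV[R]_n.+1,
    (adm z -> forall x : 'rV[R]_n.+1, (forall i, `|x ord0 i| <= r) ->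
      (forall i, exists m : int, x ord0 i = diag_scale A z ord0 i * m%:~R) -> x \in s) /\
    (size s)%:R <= (2 * r + X) ^+ n.+1 / A.
  (* Inadmissible exponents get the empty list, so that the bound is uniform in [z]. *)
  have [zX|nzX] := pselect (adm z); last first.
    exists [::]; split => //=.
    by rewrite divr_ge0 ?exprn_ge0 ?addr_ge0 ?mulr_ge0 // ltW.
  have [|s sP ss] := @lattice_ball_enumeration R n.+1 (diag_scale A z ord0) r X (ltW r0).
    by move=> i; rewrite diag_scale_gt0 //=; exact: zX.
  by exists s; split => //; rewrite prod_diag_scale in ss.
apply: (le_trans (@counting_le_size R _ _ [seq x | z <- sz, x <- f z] _)).
  move=> x [[z [xm [j zj]]] xr].
  have xir i : `|x ord0 i| <= r by apply: le_trans (le_enorm x i) xr.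
  have zX : adm z.
    by move=> i; rewrite (le_trans (zj i)) // XE ler_wpM2l ?exprn_ge0.
  apply/allpairsPdep; exists z, x; split => //; first exact: zbound.
  by have [h _] := fP z; exact: h.
rewrite lee_fin; apply: le_trans (size_flatten_le sz (fun z => (fP z).2)) _.
rewrite ler_wpM2r //.
  by rewrite divr_ge0 ?exprn_ge0 ?addr_ge0 ?mulr_ge0 // ltW.
rewrite szs prod_nat_const card_ord natrX lerXn2r ?nnegrE //.
  by rewrite addr_ge0 // mulr_ge0.
rewrite (le_trans lzs) // -natr1; lra.
Qed.

Lemma lattice_union_growth (R : realType) n : exists2 A : R, 0 < A &
  \forall r \near +oo,
    (counting (@lattice_union R n A `&` eball n.+1 r) <= (ln r ^+ n * r ^+ n.+1)%:E)%E.
Proof.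
pose c : R := 2 ^+ n.+2.
have c1 : 1 <= c by rewrite exprn_ege1 // ler1n.
have c0 : 0 < c by rewrite exprn_gt0.
pose k : R := n.+1%:R * 2 + 1.
have k1 : 1 <= k by rewrite lerDr mulr_ge0.
(* The bound of [lattice_union_ball_enumeration] has [A] only as a denominator, so [A] can be chosen
   to cancel all its constants. *)
pose A := k ^+ n * (2 + c) ^+ n.+1.
have A1 : 1 <= A.
  rewrite /A -[leLHS]mul1r ler_pM ?exprn_ege1 //.
  by rewrite -[leLHS]add0r lerD.
exists A; first by rewrite (lt_le_trans _ A1).
near=> r.
(* From r >= c follows ln (c r) <= 2 ln r, and from r >= e follows 1 <= ln r; these give the
   constant [k]. *)
have cr : c <= r by near: r; apply: nbhs_pinfty_ge; exact: num_real.
have er : expR 1 <= r by near: r; apply: nbhs_pinfty_ge; exact: num_real.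
have r1 : 1 <= r by exact: le_trans cr.
have r0 : 0 < r by rewrite (lt_le_trans _ r1).
have lr1 : 1 <= ln r by rewrite -(expRK 1) ler_ln // posrE ?expR_gt0.
apply: (le_trans (lattice_union_ball_enumeration A1 r1 erefl)).
rewrite lee_fin -/c.
have lX : n.+1%:R * ln (c * r) + 1 <= k * ln r.
  rewrite lnM ?posrE // /k mulrDl mul1r lerD // -mulrA ler_wpM2l // mulr_natl mulr2n.
  by rewrite lerD2r ler_ln ?posrE.
have -> : 2 * r + c * r = (2 + c) * r by ring.
apply: (@le_trans _ _ ((k * ln r) ^+ n * (((2 + c) * r) ^+ n.+1 / A))).
  rewrite ler_wpM2r //.
    by rewrite divr_ge0 ?(le_trans _ A1) // exprn_ge0 // mulr_ge0 ?addr_ge0 // ltW.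
  rewrite lerXn2r ?nnegrE //; first by rewrite addr_ge0 // mulr_ge0 // ln_ge0 // -[leLHS]mul1r ler_pM.
  by rewrite mulr_ge0 ?(le_trans _ k1) ?(le_trans _ lr1).
rewrite !exprMn /A le_eqVlt; apply/orP; left; apply/eqP.
have kn : k ^+ n != 0 by rewrite expf_neq0 // gt_eqF // (lt_le_trans _ k1).
have cn : (2 + c) ^+ n.+1 != 0 by rewrite expf_neq0 // gt_eqF // addr_gt0.
move: (k ^+ n) ((2 + c) ^+ n.+1) (ln r ^+ n) (r ^+ n.+1) kn cn => a b e f a0 b0.
by field; rewrite a0 b0.
Unshelve. all: by end_near. Qed.

(** * Volume of boxes *)

Lemma integral_itv_indic (R : realType) (a b s0 s1 : R) :
  a <= b -> (\int[lebesgue_measure]_(x in `[s0, s1]) ((\1_(`[a, b]%classic) x : R)%:E) <= (b - a)%:E)%E.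
Proof.
move=> ab; rewrite integral_indic //.
apply: (@le_trans _ _ (lebesgue_measure (`[a, b]%classic : set R))).
  apply: le_measure; [apply: mem_set; apply: measurableI|apply: mem_set|exact: subIsetl];
    exact: measurable_itv.
by rewrite lebesgue_measure_itv /= lte_fin; case: ltP; rewrite // lee_fin subr_ge0.
Qed.

(* The weights allow an induction on d: freezing the first coordinate x0
   multiplies the weight c k by the indicator of an interval, and the resulting
   inequality is integrated over x0. *)
Lemma weighted_box_cover_ge (R : realType) d (Q : 'rV[R]_d * 'rV[R]_d)
    (F : nat -> 'rV[R]_d * 'rV[R]_d) (c : nat -> R) :
  box_wf Q -> (forall k, box_wf (F k)) -> (forall k, 0 <= c k) ->
  (forall x, box Q x -> (1 <= \sum_(k <oo) (c k * \1_(box (F k)) x)%:E)%E) ->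
  ((box_volume Q)%:E <= \sum_(k <oo) (c k * box_volume (F k))%:E)%E.
Proof.
elim: d Q F c => [|d IH] Q F c Qwf Fwf c0 cov.
  (* In dimension 0 every box is the one-point space and has volume 1. *)
  have : box Q 0 by case.
  move/cov; rewrite /box_volume big_ord0; move/le_trans; apply.
  apply: lee_nneseries => [k _ _|k _]; first by rewrite lee_fin mulr_ge0.
  by rewrite lee_fin big_ord0 indicE mem_set //; case.
pose tl (b : 'rV[R]_d.+1 * 'rV[R]_d.+1) : 'rV[R]_d * 'rV[R]_d :=
  (\row_i b.1 ord0 (lift ord0 i), \row_i b.2 ord0 (lift ord0 i)).
have tlwf b : box_wf b -> box_wf (tl b).
  by move=> bwf i; rewrite !mxE; exact: bwf.
have volE b : box_volume b = (b.2 ord0 ord0 - b.1 ord0 ord0) * box_volume (tl b).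
  rewrite /box_volume big_ord_recl; congr (_ * _); apply: eq_bigr => i _.
  by rewrite !mxE.
have V0 b : box_wf b -> 0 <= box_volume (tl b).
  by move=> /tlwf; exact: box_volume_ge0.
pose I k : set R := `[(F k).1 ord0 ord0, (F k).2 ord0 ord0]%classic.
pose J : set R := `[Q.1 ord0 ord0, Q.2 ord0 ord0]%classic.
pose W k := c k * box_volume (tl (F k)).
have W0 k : 0 <= W k by rewrite mulr_ge0 ?V0.
have fiber x0 : J x0 ->
    ((box_volume (tl Q))%:E <= \sum_(k <oo) (W k)%:E * (\1_(I k) x0)%:E)%E.
  move=> Jx0.
  have := IH (tl Q) (fun k => tl (F k)) (fun k => c k * \1_(I k) x0) (tlwf _ Qwf)
    (fun k => tlwf _ (Fwf k)).
  have h k : 0 <= c k * \1_(I k) x0 by rewrite mulr_ge0.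
  move=> /(_ h) {}h.
  apply: (le_trans (h _)) => [y Qy|]; last first.
    apply: lee_nneseries => [k _ _|k _]; first by rewrite lee_fin mulr_ge0 ?V0 // mulr_ge0.
    by rewrite -EFinM lee_fin /W mulrAC.
  pose x : 'rV[R]_d.+1 := row_mx x0%:M y.
  have bE b : box b x <-> (b.1 ord0 ord0 <= x0 <= b.2 ord0 ord0) /\ box (tl b) y.
    split=> [bx|[b0 bt]].
      split; first by have := bx ord0; rewrite row_mx_head.
      by move=> i; have := bx (lift ord0 i); rewrite row_mx_tail !mxE.
    apply: ord_headP => [|i]; first by rewrite row_mx_head.
    by have := bt i; rewrite row_mx_tail !mxE.
  have : box Q x by apply/bE; split => //; move: Jx0; rewrite /J /= in_itv.
  move/cov/le_trans; apply.
  apply: lee_nneseries => [k _ _|k _]; first by rewrite lee_fin mulr_ge0.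
  rewrite lee_fin -mulrA ler_wpM2l // !indicE.
  have [xF|] := boolP (x \in box (F k)); last by rewrite mulr_ge0.
  have /bE[x0F yF] := set_mem xF.
  by rewrite !mem_set ?mulr1 // /I /= in_itv.
have mI k : measurable (I k) by exact: measurable_itv.
pose g k (x : R) : \bar R := ((W k)%:E * (\1_(I k) x)%:E)%E.
have m1 k : measurable_fun J (fun x : R => (\1_(I k) x : R)%:E).
  by apply/measurable_EFinP; exact: measurable_indic.
have mg k : measurable_fun J (g k) by apply: emeasurable_funM.
have g0 k x : J x -> (0 <= g k x)%E by move=> _; rewrite /g -EFinM lee_fin mulr_ge0.
have mJ : measurable J by exact: measurable_itv.
pose S (x : R) : \bar R := (\sum_(k <oo) g k x)%E.
have mS : measurable_fun J S by apply: ge0_emeasurable_sum => [k x Jx _|k _]; [exact: g0|exact: mg].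
have cst0 x : J x -> (0 <= cst (box_volume (tl Q))%:E x)%E by rewrite lee_fin V0.
have muJ : lebesgue_measure J = (Q.2 ord0 ord0 - Q.1 ord0 ord0)%:E.
  have := lebesgue_measure_itv `[Q.1 ord0 ord0, Q.2 ord0 ord0]%R.
  rewrite /= lte_fin => ->; case: ltP => // Q21; congr EFin; apply/esym/eqP.
  by rewrite subr_eq0 eq_le Q21 Qwf.
(* The fiber inequality is integrated over [J]; the terms are nonnegative, so sum and integral
   commute. *)
have := @ge0_le_integral _ _ R lebesgue_measure J mJ _ S cst0 (measurable_cst _) mS fiber.
rewrite integral_cst // /S integral_nneseries // => le_int.
have QJ : ((box_volume Q)%:E <=
    \sum_(k <oo) \int[lebesgue_measure]_(x in J) g k x)%E.
  by rewrite volE mulrC EFinM -muJ; exact: le_int.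
apply: (@le_trans _ _ (\sum_(k <oo) \int[lebesgue_measure]_(x in J) g k x)%E); last first.
  apply: lee_nneseries => [k _ _|k _]; first by apply: integral_ge0 => x; exact: g0.
  rewrite volE mulrCA EFinM ge0_integralZl_EFin //; last exact: m1.
  rewrite [leRHS]muleC; apply: lee_wpmul2l; first by rewrite lee_fin.
  by apply: integral_itv_indic; exact: Fwf.
exact: QJ.
Qed.

(** Unit weights suffice: a point of the box lies in some box of the cover, so the indicators there
    sum to at least 1. *)
Lemma box_volume_le_volume (R : realType) d (Q : 'rV[R]_d * 'rV[R]_d) :
  box_wf Q -> ((box_volume Q)%:E <= volume (box Q))%E.
Proof.
move=> Qwf; apply: le_ereal_inf_tmp => _ [F [Fwf QF] <-].
have -> : (\sum_(0 <= k <oo) (box_volume (F k))%:E =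
    \sum_(k <oo) (1 * box_volume (F k))%:E)%E.
  by apply: eq_eseriesr => k _; rewrite mul1r.
apply: weighted_box_cover_ge => // x /QF[k _ Fkx].
have f0 j : (0 <= (1 * \1_(box (F j)) x : R)%:E)%E by rewrite lee_fin mulr_ge0.
apply: (le_trans _ (nneseries_lim_ge k.+1 (fun j _ _ => f0 j))).
rewrite big_nat_recr //= [X in (_ + X)%E](_ : _ = 1%:E) ?leeDr ?sume_ge0 //.
by rewrite indicE mem_set // mulr1.
Qed.

(** * Growth of universal coverings from below *)

Lemma universal_covering_meets_boxes (R : realType) d v (U : set 'rV[R]_d) (Q : 'rV[R]_d * 'rV[R]_d) :
  v_universal_convex_covering v U -> box_wf Q -> v < box_volume Q ->
  box Q `&` U !=set0.
Proof.
(* The opposite box has the same volume, so 0 = p + q with p in -Q and q in U, and then q = -p lies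
   in Q. *)
move=> vU Qwf vQ; pose Q' := (- Q.2, - Q.1).
have Q'wf : box_wf Q' by move=> i; rewrite /= !mxE lerN2.
have Q'V : box_volume Q' = box_volume Q.
  by apply: eq_bigr => i _; rewrite !mxE opprK addrC.
have Q'conv : convex_set (box Q').
  apply/convex_setP => x y t xQ yQ t0 t1 i.
  have := xQ i; have := yQ i; rewrite /= !mxE.
  have : 0 <= 1 - t by rewrite subr_ge0.
  by move=> t1' /andP[? ?] /andP[? ?]; apply/andP; split; nra.
have : minkowski_sum (box Q') U 0.
  rewrite (vU (box Q')) //; apply: lt_le_trans (box_volume_le_volume Q'wf).
  by rewrite Q'V lte_fin.
move=> [p pQ [q qU pq]]; exists q; split => // i.
have := pQ i; have : p ord0 i + q ord0 i = 0 by move: (congr1 (fun x : 'rV[R]_d => x ord0 i) pq); rewrite /= !mxE.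
by rewrite /= !mxE => /eqP; rewrite addr_eq0 => /eqP ->; rewrite !lerN2 andbC.
Qed.

Lemma enorm_le (R : realType) d (x : 'rV[R]_d) (b : R) :
  (0 < d)%N -> (forall i, `|x ord0 i| <= b) -> enorm x <= d%:R * b.
Proof.
move=> d0 xb; have b0 : 0 <= b by exact: le_trans (xb (Ordinal d0)).
have db0 : 0 <= d%:R * b by rewrite mulr_ge0.
rewrite -[leRHS]ger0_norm // -sqrtr_sqr ler_sqrt ?sqr_ge0 //.
apply: (@le_trans _ _ (\sum_(i < d) b ^+ 2)).
  by apply: ler_sum => i _; rewrite -real_normK ?num_real // lerXn2r ?nnegrE.
rewrite sumr_const card_ord -[leLHS]mulr_natl exprMn ler_wpM2r ?sqr_ge0 //.
by rewrite -natrX ler_nat -[leqLHS]expn1 leq_pexp2l.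
Qed.

(** Closed cubes of side s placed with period 2 s are disjoint, and each contains a point of [U]; N
    ^ d of them fit in [0, 2 s N] ^ d. *)
Lemma universal_covering_growth (R : realType) d (U : set 'rV[R]_d) :
  (0 < d)%N -> universal_convex_covering U ->
  exists2 t : R, 0 < t & \forall r \near +oo,
    ((r ^+ d)%:E <= counting ([set (t *: (u + 0) : 'rV[R]_d) | u in U] `&` eball d r))%E.
Proof.
move=> d0 [v v0 vU].
(* As s >= 1 and d >= 1, s ^ d >= s > v. *)
pose s := v + 1.
have s0 : 0 < s by rewrite addr_gt0.
pose Q N (z : {ffun 'I_d -> 'I_N}) : 'rV[R]_d * 'rV[R]_d :=
  (\row_i (2 * s * (z i)%:R), \row_i (2 * s * (z i)%:R + s)).
have Qwf N z : box_wf (@Q N z) by move=> i; rewrite !mxE lerDl ltW.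
have QV N z : v < box_volume (@Q N z).
  rewrite /box_volume (eq_bigr (fun=> s)) => [|i _]; last by rewrite !mxE addrAC subrr add0r.
  rewrite prodr_const card_ord; apply: (@lt_le_trans _ _ s); first by rewrite ltrDl.
  by rewrite -[leLHS]expr1 ler_weXn2l // /s lerDr ltW.
have fex N : exists f : {ffun 'I_d -> 'I_N} -> 'rV[R]_d,
    forall z, (box (Q N z) `&` U) (f z).
  have /choice[f fP] (z : {ffun 'I_d -> 'I_N}) : exists x, (box (Q N z) `&` U) x.
    exact: universal_covering_meets_boxes vU (Qwf N z) (QV N z).
  by exists f.
(* The chosen points have norm at most 2 d s N, which [t] rescales to N / 2. *)
pose t : R := (4 * d%:R * s)^-1.
have dR : 0 < d%:R :> R by rewrite ltr0n.
have t0 : 0 < t by rewrite invr_gt0 !mulr_gt0.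
exists t => //; near=> r.
have r1 : 1 <= r by near: r; apply: nbhs_pinfty_ge; exact: num_real.
have r0 : 0 <= 2 * r by rewrite mulr_ge0 // (le_trans _ r1).
(* For r >= 1 this gives r <= N <= 2 r: enough cubes, and rescaled points within distance r. *)
pose N := Num.truncn (2 * r).
have rN : r <= N%:R.
  by have := truncnS_gt (2 * r); rewrite -natr1 -/N; lra.
have Nr : N%:R <= 2 * r by rewrite truncn_le.
have [f fP] := fex N.
have finj : injective f.
  move=> z z' e; apply/ffunP => i; apply/val_inj/eqP.
  have [/(_ i) /andP[]] := fP z; have [/(_ i) /andP[]] := fP z'.
  rewrite e !mxE => a b _ c h _; rewrite eqn_leq -!(ltnS (z i)) -!(ltnS (z' i)).
  rewrite -!(ltr_nat R) -!natr1; apply/andP; split; nra.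
pose l := [seq t *: f z | z <- enum {ffun 'I_d -> 'I_N}].
apply: (@le_trans _ _ ((size l)%:R : R)%:E).
  rewrite size_map -cardE card_ffun !card_ord natrX lee_fin.
  by rewrite lerXn2r ?nnegrE // (le_trans _ r1).
apply: le_size_counting.
  rewrite map_inj_uniq ?enum_uniq // => z z' /(congr1 ( *:%R t^-1)).
  by rewrite !scalerA mulVf ?gt_eqF // !scale1r => /finj.
move=> _ /mapP[z _ ->]; have [zQ zU] := fP z; split.
  by exists (f z); rewrite ?addr0.
rewrite /eball /=; apply: (@le_trans _ _ (d%:R * (t * (2 * s * N%:R)))).
  apply: enorm_le => // i; rewrite mxE normrM (gtr0_norm t0) ler_wpM2l ?(ltW t0) //.
  have /andP[lo hi] := zQ i; rewrite !mxE in lo hi.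
  have zi0 : 0 <= 2 * s * (z i)%:R by rewrite !mulr_ge0 // ltW.
  rewrite ger0_norm; last exact: le_trans zi0 lo.
  apply: (le_trans hi).
  have : (z i)%:R + 1 <= N%:R :> R by rewrite natr1 ler_nat.
  by nra.
have -> : d%:R * (t * (2 * s * N%:R)) = N%:R / 2.
  by rewrite /t; field; rewrite !gt_eqF.
by lra.
Unshelve. all: by end_near. Qed.

Theorem theorem1p1 (R : realType) (d : nat) (hd : (1 <= d)%N) :
  (forall U : set 'rV[R]_d, universal_convex_covering U ->
    exists (a : 'rV[R]_d) (t : R), 0 < t /\
      \forall r \near +oo,
        (((r : R) ^+ d)%:E <=
           counting ([set (t *: (u + a) : 'rV[R]_d) | u in U] `&` eball d r))%E)
  /\
  (exists U : set 'rV[R]_d, universal_convex_covering U /\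
    \forall r \near +oo,
      (counting (U `&` eball d r) <= (ln r ^+ d.-1 * r ^+ d)%:E)%E).
Proof.
split=> [U UU|].
  have [t t0 tU] := universal_covering_growth hd UU.
  by exists 0, t; split.
case: d hd => // n _.
have [A A0 AU] := lattice_union_growth R n.
by exists (@lattice_union R n A); split => //; exact: lattice_union_universal.
Qed.
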